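(* Let $\mathbb{K}$ be a field and $G$ a group. Suppose that $\Delta$ is a connected component of the groupoid $\Gamma(G)$ with finitely many vertices, $A$ is a vertex of $\Delta$ and $G\setminus A$ is infinite. Then $\mathbb{K}\Delta$ is not a projective left $\mathbb{K}_{par}G$-module.
   Context: $\mathbb{K}_{par}G$ is the unital associative $\mathbb{K}$-algebra generated by symbols $[g]$, $g\in G$, subject to $[g][h][h^{-1}]=[gh][h^{-1}]$, $[g^{-1}][g][h]=[g^{-1}][gh]$ and $[1]=1$ for all $g,h\in G$. $\Gamma(G)$ is the groupoid whose objects (vertices) are the subsets of $G$ containing $1$ and whose morphisms are the pairs $(A,g)$ with $A\subseteq G$ and $1,g^{-1}\in A$; $(A,g)$ is an arrow from $A$ to $gA$, and $(gA,g')\circ(A,g)=(A,g'g)$. For a connected component $\Delta$, $\mathcal{V}_\Delta$ is its set of vertices, and $\mathbb{K}\Delta$ is the groupoid algebra (basis: the morphisms of $\Delta$; product is composition when defined and $0$ otherwise). When $\mathcal{V}_\Delta$ is finite there is an algebra homomorphism $\lambda_\Delta:\mathbb{K}_{par}G\to\mathbb{K}\Delta$, $\lambda_\Delta([g])=\sum_{C\in\mathcal{V}_\Delta,\ g^{-1}\in C}(C,g)$, and $\mathbb{K}\Delta$ is viewed as a left $\mathbb{K}_{par}G$-module via $[g]\cdot a=\lambda_\Delta([g])a$. *)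

(* Defs.v *)
From HB Require Import structures.
From mathcomp Require Import all_boot all_algebra finmap.
From mathcomp Require Import boolp classical_sets functions cardinality fsbigop.
From mathcomp Require Import monalg.

Set Implicit Arguments.
Unset Strict Implicit.
Unset Printing Implicit Defensive.

Import GRing.Theory.
Local Open Scope classical_set_scope.
Local Open Scope ring_scope.

Definition projective (R : pzRingType) (P : lmodType R) : Prop :=
  forall (M N : lmodType R) (f : {linear M -> N}) (g : {linear P -> N}),
    (forall y : N, exists x : M, f x = y) ->
    exists h : {linear P -> M}, forall p : P, f (h p) = g p.

Definition two_sided_ideal (R : pzRingType) (I : set R) : Prop :=
  [/\ I 0, forall x y, I x -> I y -> I (x - y)
    & forall a x b, I x -> I (a * x * b)].

Definition free_monoid (X : Type) : Type := seq X.

HB.instance Definition _ (X : choiceType) := Choice.on (free_monoid X).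

Lemma cat_eq_nil (X : Type) (s t : seq X) :
  s ++ t = [::] -> s = [::] /\ t = [::].
Proof. by case: s => //; case: t. Qed.

HB.instance Definition _ (X : choiceType) :=
  Choice_isMonomialDef.Build (free_monoid X)
    (@catA X) (@cat0s X) (@cats0 X) (@cat_eq_nil X).

Section FreeAlgebra.
Context (K : fieldType) (X : choiceType).
Local Notation F := {malg K[free_monoid X]}.

Definition letter (x : X) : F := << ([:: x] : free_monoid X) >>.

Lemma free_algebra_scalerAr (c : K) (a b : F) : c *: (a * b) = a * (c *: b).
Proof.
have cC (d : K) (u : F) : u * d%:MP = d%:MP * u.
  rewrite !malgM_def fgmulUg fgmulgU; apply: eq_bigr => k _.
  by rewrite mulrC mul1m mulm1.
by rewrite -!mul_malgC mulrA -cC mulrA.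
Qed.

Context (S : algType K) (phi : X -> S).

Definition word_eval (w : free_monoid X) : S := \prod_(x <- w) phi x.

Lemma word_eval_mmorphism : mmorphism word_eval.
Proof.
split; last by rewrite /word_eval big_nil.
by move=> u v; rewrite /word_eval big_cat.
Qed.
HB.instance Definition _ :=
  isMultiplicative.Build _ _ word_eval word_eval_mmorphism.

Definition free_eval : F -> S := mmap (in_alg S) word_eval.

Lemma free_eval_is_zmod_morphism : zmod_morphism free_eval.
Proof. by move=> a b; rewrite /free_eval mmapB. Qed.

Lemma free_eval_is_monoid_morphism : monoid_morphism free_eval.
Proof.
have [] := @commr_mmap_is_multiplicative _ _ _ (in_alg S) word_eval.
  by move=> g m m'; rewrite /GRing.comm mulr_algl mulr_algr.
by split.
Qed.

HB.instance Definition _ :=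
  GRing.isZmodMorphism.Build F S free_eval free_eval_is_zmod_morphism.
HB.instance Definition _ :=
  GRing.isMonoidMorphism.Build F S free_eval free_eval_is_monoid_morphism.

Lemma free_evalZ (c : K) (a : F) : free_eval (c *: a) = c *: free_eval a.
Proof. by rewrite /free_eval mmapZ /= mulr_algl. Qed.

Lemma free_eval_letter x : free_eval (letter x) = phi x.
Proof. by rewrite /free_eval mmapU /word_eval big_seq1 /= scale1r mul1r. Qed.

End FreeAlgebra.

Section PartialGroupAlgebra.
Context (K : fieldType) (G : groupType).
Local Notation F := {malg K[free_monoid G]}.
Local Notation "'X_ g" := (letter K g%g) (at level 8, g at level 2).

Definition par_relators : set F :=
  [set r | exists g h : G, r = 'X_g * 'X_h * 'X_(h^-1) - 'X_(g * h) * 'X_(h^-1)]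
  `|` [set r | exists g h : G,
         r = 'X_(g^-1) * 'X_g * 'X_h - 'X_(g^-1) * 'X_(g * h)]
  `|` [set 'X_1 - 1].

Definition par_ideal : set F := smallest (@two_sided_ideal F) par_relators.

Lemma par_ideal_two_sided : two_sided_ideal par_ideal.
Proof.
split.
- by move=> I [[I0 _ _] _] /=.
- by move=> x y Ix Iy I II; have [[_ ID _] _] := II; exact: ID (Ix I II) (Iy I II).
- by move=> a x b Ix I II; have [[_ _ IM] _] := II; exact: IM (Ix I II).
Qed.

Definition par_ideal_pred : pred F := fun a => a \in par_ideal.

Lemma par_ideal_zmod_closed : zmod_closed par_ideal_pred.
Proof.
have [I0 ID _] := par_ideal_two_sided.
split; first exact/mem_set.
by by move=> x y /set_mem Ix /set_mem Iy; apply: mem_set; exact: ID.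
Qed.
HB.instance Definition _ :=
  GRing.isZmodClosed.Build F par_ideal_pred par_ideal_zmod_closed.

Definition par_relations (S : pzRingType) (phi : G -> S) : Prop :=
  [/\ forall g h, phi g * phi h * phi h^-1%g = phi (g * h)%g * phi h^-1%g,
      forall g h, phi g^-1%g * phi g * phi h = phi g^-1%g * phi (g * h)%g
    & phi 1%g = 1].

Lemma free_eval_par_ideal (S : algType K) (phi : G -> S) (a : F) :
  par_relations phi -> par_ideal a -> free_eval phi a = 0.
Proof.
move=> [r1 r2 r3].
suff: par_ideal `<=` [set a | free_eval phi a = 0] by apply.
apply: smallest_sub.
  split=> /= [|x y x0 y0|b x c x0]; first exact: rmorph0.
    by rewrite rmorphB /= x0 y0 subr0.
  by rewrite !rmorphM /= x0 mulr0 mul0r.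
move=> r [[|]|] /=.
- by move=> [g [h ->]]; rewrite rmorphB !rmorphM /= !free_eval_letter r1 subrr.
- by move=> [g [h ->]]; rewrite rmorphB !rmorphM /= !free_eval_letter r2 subrr.
- by move=> ->; rewrite rmorphB rmorph1 /= free_eval_letter r3 subrr.
Qed.

Lemma par_ideal_proper : ~ par_ideal 1.
Proof.
move=> /(@free_eval_par_ideal K^o (fun=> 1)); rewrite rmorph1 => H.
have /H /eqP : @par_relations K^o (fun=> 1) by split=> *; rewrite ?mulr1.
by rewrite oner_eq0.
Qed.

Definition par_ideal_zmod : zmodClosed F :=
  GRing.ZmodClosed.clone F par_ideal_pred _.

Definition par_algebra : Type := Quotient.quot par_ideal_zmod.
HB.instance Definition _ := GRing.Zmodule.on par_algebra.

Definition par_pi (a : F) : par_algebra := \pi_(Quotient.quot par_ideal_zmod)%qT a.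
Definition par_repr (x : par_algebra) : F := repr x.

Lemma par_piP a b : par_pi a = par_pi b <-> par_ideal (a - b).
Proof.
have := Quotient.idealrBE par_ideal_zmod a b.
rewrite -[LHS]/((a - b) \in par_ideal) => E; split.
  by move=> ab; apply: set_mem; rewrite E; apply/eqP.
by move=> /mem_set; rewrite E => /eqP.
Qed.

Lemma par_reprK x : par_pi (par_repr x) = x.
Proof. exact: reprK. Qed.

Lemma par_piB : {morph par_pi : a b / a - b}.
Proof. by move=> a b; rewrite /par_pi raddfB. Qed.

Lemma par_piD : {morph par_pi : a b / a + b}.
Proof. by move=> a b; rewrite /par_pi raddfD. Qed.

Definition par_one : par_algebra := par_pi 1.
Definition par_mul : par_algebra -> par_algebra -> par_algebra :=
  lift_op2 (Quotient.quot par_ideal_zmod) *%R.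
Definition par_scale (c : K) : par_algebra -> par_algebra :=
  lift_op1 (Quotient.quot par_ideal_zmod) ( *:%R c).

Lemma par_mulE x y : par_mul x y = par_pi (par_repr x * par_repr y).
Proof. by unlock par_mul. Qed.

Lemma par_scaleE c x : par_scale c x = par_pi (c *: par_repr x).
Proof. by unlock par_scale. Qed.

Lemma par_repr_pi a : par_ideal (par_repr (par_pi a) - a).
Proof. exact/par_piP/par_reprK. Qed.

Lemma par_piM a b : par_mul (par_pi a) (par_pi b) = par_pi (a * b).
Proof.
have [I0 IB IM] := par_ideal_two_sided.
rewrite par_mulE; apply/par_piP; set a' := par_repr _; set b' := par_repr _.
have -> : a' * b' - a * b = (a' - a) * b' - a * (b - b').
  by rewrite mulrBl mulrBr opprB addrA subrK.
have Ia : par_ideal ((a' - a) * b').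
  by rewrite -[a' - a]mul1r; exact: IM (par_repr_pi a).
have Ib : par_ideal (a * (b - b')).
  rewrite -[_ * _]mulr1 -opprB -sub0r.
  exact: IM (IB _ _ I0 (par_repr_pi b)).
exact: IB Ia Ib.
Qed.

Lemma par_piZ c a : par_scale c (par_pi a) = par_pi (c *: a).
Proof.
have [I0 IB IM] := par_ideal_two_sided.
rewrite par_scaleE; apply/par_piP; rewrite -scalerBr -mul_malgC -[_ * _]mulr1.
exact: IM (par_repr_pi a).
Qed.

Lemma par_mulA : associative par_mul.
Proof.
move=> x y z; rewrite -[x]par_reprK -[y]par_reprK -[z]par_reprK.
by rewrite !par_piM mulrA.
Qed.
Lemma par_mul1 : left_id par_one par_mul.
Proof. by move=> x; rewrite -[x]par_reprK par_piM mul1r. Qed.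
Lemma par_mulr1 : right_id par_one par_mul.
Proof. by move=> x; rewrite -[x]par_reprK par_piM mulr1. Qed.
Lemma par_mulDl : left_distributive par_mul +%R.
Proof.
move=> x y z; rewrite -[x]par_reprK -[y]par_reprK -[z]par_reprK.
by rewrite !(par_piM, =^~ par_piD) mulrDl.
Qed.
Lemma par_mulDr : right_distributive par_mul +%R.
Proof.
move=> x y z; rewrite -[x]par_reprK -[y]par_reprK -[z]par_reprK.
by rewrite !(par_piM, =^~ par_piD) mulrDr.
Qed.
Lemma par_one_neq0 : par_one != 0.
Proof.
apply/eqP => E; apply: par_ideal_proper; rewrite -[1]subr0.
by apply/par_piP; rewrite -[par_pi 1]/par_one E /par_pi raddf0.
Qed.
HB.instance Definition _ := GRing.Zmodule_isNzRing.Build par_algebra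
  par_mulA par_mul1 par_mulr1 par_mulDl par_mulDr par_one_neq0.

Lemma par_pi_mulr (a b : F) : par_pi (a * b) = par_pi a * par_pi b.
Proof. by rewrite -par_piM. Qed.

Lemma par_scaleA c d x : par_scale c (par_scale d x) = par_scale (c * d) x.
Proof. by rewrite -[x]par_reprK !par_piZ scalerA. Qed.
Lemma par_scale1 : left_id 1 par_scale.
Proof. by move=> x; rewrite -[x]par_reprK par_piZ scale1r. Qed.
Lemma par_scaleDr : right_distributive par_scale +%R.
Proof.
move=> c x y; rewrite -[x]par_reprK -[y]par_reprK.
by rewrite !(par_piZ, =^~ par_piD) scalerDr.
Qed.
Lemma par_scaleDl x : {morph par_scale^~ x : c d / c + d}.
Proof.
by move=> c d; rewrite -[x]par_reprK !(par_piZ, =^~ par_piD) scalerDl.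
Qed.
HB.instance Definition _ := GRing.Zmodule_isLmodule.Build K par_algebra
  par_scaleA par_scale1 par_scaleDr par_scaleDl.

Lemma par_pi_scaler c (a : F) : par_pi (c *: a) = c *: par_pi a.
Proof. by rewrite -par_piZ. Qed.

Lemma par_scaleAl c (x y : par_algebra) : c *: (x * y) = (c *: x) * y.
Proof.
rewrite -[x]par_reprK -[y]par_reprK.
by rewrite -par_pi_mulr -!par_pi_scaler -par_pi_mulr scalerAl.
Qed.
HB.instance Definition _ :=
  GRing.Lmodule_isLalgebra.Build K par_algebra par_scaleAl.

Lemma par_scaleAr c (x y : par_algebra) : c *: (x * y) = x * (c *: y).
Proof.
rewrite -[x]par_reprK -[y]par_reprK.
by rewrite -par_pi_mulr -!par_pi_scaler -par_pi_mulr free_algebra_scalerAr.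
Qed.
HB.instance Definition _ :=
  GRing.Lalgebra_isAlgebra.Build K par_algebra par_scaleAr.

Definition par_gen (g : G) : par_algebra := par_pi ('X_g).

Lemma par_gen_relations : par_relations par_gen.
Proof.
have sub a b : par_relators (a - b) -> par_pi a = par_pi b.
  by move=> ab; apply/par_piP; exact: sub_gen_smallest ab.
rewrite /par_gen; split=> [g h|g h|].
- by rewrite -!par_pi_mulr; apply: sub; left; left; exists g, h.
- by rewrite -!par_pi_mulr; apply: sub; left; right; exists g, h.
- by apply: sub; right.
Qed.

Section Lift.
Context (S : algType K) (phi : G -> S) (phiP : par_relations phi).

Definition par_lift of par_relations phi : par_algebra -> S :=
  fun x => free_eval phi (par_repr x).
Local Notation lift := (par_lift phiP).

Lemma par_lift_pi a : lift (par_pi a) = free_eval phi a.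
Proof.
apply/eqP; rewrite -subr_eq0 -rmorphB; apply/eqP.
exact: (free_eval_par_ideal phiP (par_repr_pi a)).
Qed.

Lemma par_lift_is_zmod_morphism : zmod_morphism lift.
Proof.
move=> x y; rewrite -[x]par_reprK -[y]par_reprK -par_piB !par_lift_pi.
exact: rmorphB.
Qed.

Lemma par_lift_is_monoid_morphism : monoid_morphism lift.
Proof.
split; first by rewrite par_lift_pi rmorph1.
move=> x y; rewrite -[x]par_reprK -[y]par_reprK.
by rewrite -par_pi_mulr !par_lift_pi rmorphM.
Qed.

Lemma par_lift_scalable : scalable lift.
Proof.
move=> c x; rewrite -[x]par_reprK /GRing.scale /= par_piZ !par_lift_pi.
exact: free_evalZ.
Qed.

HB.instance Definition _ := GRing.isZmodMorphism.Build par_algebra S lift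
  par_lift_is_zmod_morphism.
HB.instance Definition _ := GRing.isMonoidMorphism.Build par_algebra S lift
  par_lift_is_monoid_morphism.
HB.instance Definition _ := GRing.isScalable.Build K par_algebra S *:%R lift
  par_lift_scalable.

Lemma par_lift_gen g : lift (par_gen g) = phi g.
Proof. by rewrite par_lift_pi free_eval_letter. Qed.

End Lift.

End PartialGroupAlgebra.

(* [pmul] and [lambda_gen] are locked to keep unification from unfolding the
   sums; see [pmulE] and [lambda_genE]. *)

Section PartialProduct.
Context (K : fieldType) (X : choiceType) (op : X -> X -> option X).
Local Notation M := {malg K[X]}.

Definition basis_or0 (o : option X) : M := oapp (fun x => << x >>) 0 o.

Definition pmul : M -> M -> M := locked (fun a b =>
  \sum_(x <- msupp a) \sum_(y <- msupp b) (a@_x * b@_y) *: basis_or0 (op x y)).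

Lemma pmulE (a b : M) : pmul a b =
  \sum_(x <- msupp a) \sum_(y <- msupp b) (a@_x * b@_y) *: basis_or0 (op x y).
Proof. by unlock pmul. Qed.

Lemma pmul_widen (d1 d2 : {fset X}) (a b : M) :
  (msupp a `<=` d1)%fset -> (msupp b `<=` d2)%fset ->
  pmul a b =
    \sum_(x <- d1) \sum_(y <- d2) (a@_x * b@_y) *: basis_or0 (op x y).
Proof.
move=> le_d1 le_d2; rewrite pmulE (big_fset_incl _ le_d1) /=.
  apply/eq_bigr => x _; apply/big_fset_incl => // y _ /mcoeff_outdom ->.
  by rewrite mulr0 scale0r.
by move=> x _ /mcoeff_outdom ax; rewrite big1 // => y _; rewrite ax mul0r scale0r.
Qed.

Lemma pmulDl : left_distributive pmul +%R.
Proof.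
move=> a b c; have sc := fsubset_refl (msupp c).
rewrite (pmul_widen (msuppD_le _ _) sc).
rewrite (pmul_widen (fsubsetUl _ (msupp b)) sc).
rewrite (pmul_widen (fsubsetUr (msupp a) _) sc).
rewrite -big_split; apply/eq_bigr => x _; rewrite -big_split.
by apply/eq_bigr => y _; rewrite mcoeffD mulrDl scalerDl.
Qed.

Lemma pmulDr : right_distributive pmul +%R.
Proof.
move=> c a b; have sc := fsubset_refl (msupp c).
rewrite (pmul_widen sc (msuppD_le _ _)).
rewrite (pmul_widen sc (fsubsetUl _ (msupp b))).
rewrite (pmul_widen sc (fsubsetUr (msupp a) _)).
rewrite -big_split; apply/eq_bigr => x _; rewrite -big_split.
by apply/eq_bigr => y _; rewrite mcoeffD mulrDr scalerDl.
Qed.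

Lemma pmulZl k (a b : M) : k *: pmul a b = pmul (k *: a) b.
Proof.
rewrite (pmul_widen (msuppZ_le _ _) (fsubset_refl _)) pmulE scaler_sumr.
apply/eq_bigr => x _; rewrite scaler_sumr; apply/eq_bigr => y _.
by rewrite scalerA mcoeffZ mulrA.
Qed.

Lemma pmulZr k (a b : M) : k *: pmul a b = pmul a (k *: b).
Proof.
rewrite (pmul_widen (fsubset_refl _) (msuppZ_le _ _)) pmulE scaler_sumr.
apply/eq_bigr => x _; rewrite scaler_sumr; apply/eq_bigr => y _.
by rewrite scalerA mcoeffZ mulrCA.
Qed.

Lemma pmul0l b : pmul 0 b = 0.
Proof. by have := pmulZl 0 0 b; rewrite !scale0r. Qed.

Lemma pmul0r a : pmul a 0 = 0.
Proof. by have := pmulZr 0 a 0; rewrite !scale0r. Qed.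

Lemma pmulUU x y : pmul << x >> << y >> = basis_or0 (op x y).
Proof.
rewrite (pmul_widen msuppU_le msuppU_le) !big_seq_fset1 !mcoeffUU.
by rewrite mulr1 scale1r.
Qed.

Lemma malg_basis_ind (P : M -> Prop) :
  P 0 -> (forall a b, P a -> P b -> P (a + b)) ->
  (forall k a, P a -> P (k *: a)) -> (forall x, P << x >>) -> forall a, P a.
Proof.
move=> P0 PD PZ PU a; rewrite [a]monalgE; elim/big_rec: _ => // x b _ Pb.
apply: PD => //; suff -> : << a@_x *g x >> = a@_x *: (<< x >> : M).
  exact/PZ/PU.
by apply/malgP => y; rewrite mcoeffZ !mcoeffU mulr_natr.
Qed.

Lemma pmul_basis_r x o :
  pmul << x >> (basis_or0 o) = basis_or0 (obind (op x) o).
Proof. by case: o => [y|] /=; rewrite ?pmulUU ?pmul0r. Qed.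

Lemma pmul_basis_l o z :
  pmul (basis_or0 o) << z >> = basis_or0 (obind (op^~ z) o).
Proof. by case: o => [y|] /=; rewrite ?pmulUU ?pmul0l. Qed.

Lemma pmulA :
  (forall x y z, obind (op x) (op y z) = obind (op^~ z) (op x y)) ->
  associative pmul.
Proof.
move=> opA a b c.
elim/malg_basis_ind: a => [|a a' Ha Ha'|k a Ha|x].
- by rewrite !pmul0l.
- by rewrite !pmulDl Ha Ha'.
- by rewrite -!pmulZl Ha.
elim/malg_basis_ind: b => [|b b' Hb Hb'|k b Hb|y].
- by rewrite !(pmul0l, pmul0r).
- by rewrite !(pmulDl, pmulDr) Hb Hb'.
- by rewrite -[pmul (k *: b) c]pmulZl -!pmulZr -pmulZl Hb.
elim/malg_basis_ind: c => [|c c' Hc Hc'|k c Hc|z].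
- by rewrite !pmul0r.
- by rewrite !pmulDr Hc Hc'.
- by rewrite -!pmulZr Hc.
by rewrite !pmulUU pmul_basis_r pmul_basis_l opA.
Qed.

Lemma pmul_fsuml (D : set X) b : finite_set D ->
  pmul (\sum_(x \in D) (<< x >> : M)) b = \sum_(x \in D) pmul << x >> b.
Proof.
move=> finD; rewrite !fsbig_finite //=.
by rewrite (big_morph (pmul^~ b) (fun _ _ => pmulDl _ _ _) (pmul0l _)).
Qed.

Lemma pmul_fsumr (D : set X) a : finite_set D ->
  pmul a (\sum_(x \in D) (<< x >> : M)) = \sum_(x \in D) pmul a << x >>.
Proof.
move=> finD; rewrite !fsbig_finite //=.
by rewrite (big_morph (pmul a) (pmulDr _) (pmul0r _)).
Qed.

Lemma fsum_single (D : set X) (F : X -> M) x0 : finite_set D -> D x0 ->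
  (forall x, D x -> x != x0 -> F x = 0) -> \sum_(x \in D) F x = F x0.
Proof.
move=> finD Dx0 F0; rewrite fsbig_finite //=.
rewrite (bigD1_seq x0) ?fset_uniq //=; last by rewrite in_fset_set ?mem_set.
rewrite big_seq_cond big1 ?addr0 // => x /andP[].
by rewrite in_fset_set // => /set_mem Dx; exact: F0.
Qed.

End PartialProduct.

Section Groupoid.
Context (G : groupType).
Implicit Types (A B : set G) (g h : G).

Definition translate g A : set G := [set (g * x)%g | x in A].

Definition is_vertex A : Prop := A 1%g.

(* [is_arrow A g]: the pair [(A, g)] is a morphism, from [A] to [translate g A]. *)
Definition is_arrow A g : Prop := A 1%g /\ A g^-1%g.

Definition connected_vertices A B : Prop :=
  exists2 g : G, is_arrow A g & translate g A = B.

Record component := Component {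
  vertices : set (set G);
  verticesP : exists2 A, is_vertex A & vertices = [set B | connected_vertices A B]
}.

Lemma translateM g h A : translate (g * h)%g A = translate g (translate h A).
Proof.
rewrite /translate image_comp; congr (_ @` _); apply/funext => x /=.
by rewrite mulgA.
Qed.

Lemma translate1 A : translate 1%g A = A.
Proof.
rewrite /translate -[RHS]image_id; congr (_ @` _); apply/funext => x.
exact: mul1g.
Qed.

Lemma translateE g A x : translate g A x <-> A (g^-1 * x)%g.
Proof.
split=> [[y Ay <-]|Ax]; first by rewrite mulKg.
by exists (g^-1 * x)%g => //; rewrite mulVKg.
Qed.

Lemma vertices_vertex (D : component) A : vertices D A -> is_vertex A.
Proof.
have [B B1 ->] := verticesP D; move=> [g [_ Bg] <-].
by apply/translateE; rewrite mulg1.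
Qed.

Lemma vertices_closed (D : component) A g :
  vertices D A -> is_arrow A g -> vertices D (translate g A).
Proof.
have [B B1 ->] := verticesP D; move=> [h [_ Bh] <-] [_ /translateE hg].
by exists (g * h)%g; [split; rewrite // invgM|rewrite translateM].
Qed.

End Groupoid.

Section Component.
Context (G : groupType) (D : component G).

(* The morphisms of the component [D]; by [vertices_closed] their targets are
   vertices of [D] as well. *)
Definition arrow : Type :=
  {p : set G * G | `[< vertices D p.1 /\ is_arrow p.1 p.2 >]}.

HB.instance Definition _ := SubChoice.on arrow.

Definition source (f : arrow) : set G := (val f).1.
Definition label (f : arrow) : G := (val f).2.
Definition target (f : arrow) : set G := translate (label f) (source f).

(* By [arrow_compP], this is [None] exactly when [f'] and [f] are not
   composable. *)
Definition arrow_comp (f' f : arrow) : option arrow :=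
  if source f' == target f then insub (source f, (label f' * label f)%g)
  else None.

Lemma arrowP (f : arrow) : vertices D (source f) /\ is_arrow (source f) (label f).
Proof. exact/asboolP/(valP f). Qed.

Lemma arrow_eq (f f' : arrow) : source f = source f' -> label f = label f' -> f = f'.
Proof. by move=> es el; apply: val_inj; apply/eqP/andP; split; apply/eqP. Qed.

Lemma target_vertex (f : arrow) : vertices D (target f).
Proof. by have [v a] := arrowP f; exact: vertices_closed. Qed.

Lemma arrowK (f : arrow) : insub (source f, label f) = Some f.
Proof. by rewrite -surjective_pairing valK. Qed.

Lemma insub_arrow A g : vertices D A -> is_arrow A g ->
  exists f : arrow,
    [/\ insub (A, g) = Some f, source f = A & label f = g].
Proof.
move=> vA aA; have p : `[< vertices D (A, g).1 /\ is_arrow (A, g).1 (A, g).2 >].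
  exact/asboolP.
by exists (Sub (A, g) p); rewrite insubT /source /label SubK.
Qed.

Lemma arrow_compP (f' f : arrow) : source f' = target f ->
  exists k : arrow, [/\ arrow_comp f' f = Some k, source k = source f,
    label k = (label f' * label f)%g & target k = target f'].
Proof.
move=> e; have [v [f1 _]] := arrowP f; have [_ [_ f'V]] := arrowP f'.
have [|k [ck sk lk]] := @insub_arrow (source f) (label f' * label f)%g v.
  by split=> //; rewrite invgM; move: f'V; rewrite e => /translateE.
exists k; split=> //; first by rewrite /arrow_comp e eqxx.
by rewrite /target sk lk translateM -/(target f) -e.
Qed.

Lemma arrow_comp_none (f' f : arrow) :
  source f' <> target f -> arrow_comp f' f = None.
Proof. by rewrite /arrow_comp => /eqP/negPf ->. Qed.

Lemma arrow_compA (x y z : arrow) :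
  obind (arrow_comp x) (arrow_comp y z) = obind (arrow_comp^~ z) (arrow_comp x y).
Proof.
have [yz|yz] := eqVneq (source y) (target z); last first.
  rewrite arrow_comp_none /=; last exact/eqP.
  have [xy|/eqP xy] := eqVneq (source x) (target y); last first.
    by rewrite arrow_comp_none.
  have [k [-> sk _ _]] := arrow_compP xy.
  by rewrite /= arrow_comp_none // sk; apply/eqP.
have [k [-> sk lk tk]] := arrow_compP yz.
have [xy|/eqP xy] := eqVneq (source x) (target y); last first.
  by rewrite (arrow_comp_none xy) /= arrow_comp_none // tk.
have [l [-> sl ll tl]] := arrow_compP xy.
by rewrite /= /arrow_comp tk sl xy yz !eqxx sk lk ll mulgA.
Qed.

End Component.

Section GroupoidAlgebra.
Context (K : fieldType) (G : groupType) (D : component G).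
Local Notation arrow := (arrow D).
Local Notation M := {malg K[arrow]}.
Local Notation mul := (@pmul K arrow (@arrow_comp G D)).

(* The arrows labelled [g] are the pairs [(C, g)] with [C] a vertex of [D] and
   [g^-1 \in C]. *)
Definition labelled (g : G) : set arrow := [set f | label f = g].

Definition lambda_gen : G -> M := locked (fun g =>
  \sum_(f \in labelled g) (<< f >> : M)).

Lemma lambda_genE g : lambda_gen g = \sum_(f \in labelled g) (<< f >> : M).
Proof. by unlock lambda_gen. Qed.


Definition translate_arrow (g : G) (f : arrow) : option arrow :=
  insub (source f, (g * label f)%g).

Lemma translate_arrow_eq g f A h :
  source f = A -> (g * label f)%g = h -> translate_arrow g f = insub (A, h).
Proof. by move=> <- <-. Qed.

Lemma translate_arrowP g f : match translate_arrow g f with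
  | Some f' => source f' = source f /\ label f' = (g * label f)%g
  | None => ~ source f (g * label f)^-1%g
  end.
Proof.
rewrite /translate_arrow; case: insubP => [f' _ ef'|].
  by rewrite /source /label ef'.
move=> /asboolPn nP fV; apply: nP; have [vf [f1 _]] := arrowP f.
by split.
Qed.

Lemma translate_arrow_rel1 g h f :
  obind (translate_arrow g) (obind (translate_arrow h) (translate_arrow h^-1%g f))
  = obind (translate_arrow (g * h)%g) (translate_arrow h^-1%g f).
Proof.
have := translate_arrowP h^-1%g f.
case: (translate_arrow h^-1%g f) => [f1 [s1 l1]|] //=.
have hf1 : (h * label f1)%g = label f by rewrite l1 mulVKg.
rewrite (translate_arrow_eq s1 hf1) arrowK /=.
by rewrite [RHS](@translate_arrow_eq _ _ (source f) (g * label f)%g) // -mulgA hf1.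
Qed.

Lemma translate_arrow_rel2 g h f :
  obind (translate_arrow g^-1%g) (obind (translate_arrow g) (translate_arrow h f))
  = obind (translate_arrow g^-1%g) (translate_arrow (g * h)%g f).
Proof.
have := translate_arrowP h f.
case E : (translate_arrow h f) => [f1|] /=.
  move=> [s1 l1]; congr obind; apply: translate_arrow_eq => //.
  by rewrite l1 mulgA.
have := translate_arrowP (g * h)%g f.
case: (translate_arrow (g * h)%g f) => [f1 [s1 l1] nf|] //=.
rewrite -E /translate_arrow s1 l1; congr insub; congr pair.
by rewrite -mulgA mulKg.
Qed.

Lemma translate_arrow1 f : translate_arrow 1%g f = Some f.
Proof. by rewrite /translate_arrow mul1g arrowK. Qed.

Hypothesis fin : finite_set (vertices D).

Lemma labelled_finite g : finite_set (labelled g).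
Proof.
have inj : {in labelled g &, injective (@source G D)}.
  by move=> f f' /set_mem lf /set_mem lf' e; apply: arrow_eq => //; rewrite lf.
rewrite -(eq_finite_set (inj_card_eq inj)).
apply: sub_finite_set fin => _ [f _ <-].
by have [] := arrowP f.
Qed.

Lemma lambda_genU g f :
  mul (lambda_gen g) << f >> = basis_or0 K (translate_arrow g f).
Proof.
rewrite lambda_genE pmul_fsuml; last exact: labelled_finite.
have [fV|nfV] := pselect (target f g^-1%g).
  have [||x0 [_ s0 l0]] := @insub_arrow _ D (target f) g.
  - exact: target_vertex.
  - by split=> //; apply: vertices_vertex (target_vertex f).
  rewrite (fsum_single (x0 := x0)) ?pmulUU; first last.
  - move=> x lx /eqP nx; rewrite pmulUU arrow_comp_none // => sx; apply: nx.
    by apply: arrow_eq; rewrite ?s0 // l0.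
  - exact: l0.
  - exact: labelled_finite.
  by rewrite /arrow_comp s0 eqxx l0.
rewrite fsbig1 => [|x lx].
  have := translate_arrowP g f; case: translate_arrow => // f' [sf' lf'].
  case: nfV; apply/translateE; have [_ [_]] := arrowP f'.
  by rewrite sf' lf' invgM.
rewrite pmulUU arrow_comp_none // => sx; apply: nfV; rewrite -sx -lx.
by have [_ []] := arrowP x.
Qed.

Lemma lambda_gen_basis g o :
  mul (lambda_gen g) (basis_or0 K o) = basis_or0 K (obind (translate_arrow g) o).
Proof. by case: o => [f|] /=; rewrite ?lambda_genU // pmul0r. Qed.

Lemma groupoid_mulA : associative mul.
Proof. exact/pmulA/arrow_compA. Qed.

Lemma groupoid_mul1 : left_id (lambda_gen 1%g) mul.
Proof.
elim/malg_basis_ind => [|a b Ha Hb|k a Ha|f].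
- by rewrite pmul0r.
- by rewrite pmulDr Ha Hb.
- by rewrite -pmulZr Ha.
by rewrite lambda_genU translate_arrow1.
Qed.

Lemma groupoid_mulr1 : right_id (lambda_gen 1%g) mul.
Proof.
elim/malg_basis_ind => [|a b Ha Hb|k a Ha|f].
- by rewrite pmul0l.
- by rewrite pmulDl Ha Hb.
- by rewrite -pmulZl Ha.
rewrite lambda_genE pmul_fsumr; last exact: labelled_finite.
have [vf [f1 _]] := arrowP f.
have [|e [_ se le]] := @insub_arrow _ D (source f) 1%g vf.
  by split; rewrite // invg1.
rewrite (fsum_single (x0 := e)) ?pmulUU; first last.
- move=> x lx /eqP nx; rewrite pmulUU arrow_comp_none // => sx; apply: nx.
  by apply: arrow_eq; rewrite ?le // se sx /target lx translate1.
- exact: le.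
- exact: labelled_finite.
by rewrite /arrow_comp /target se le translate1 eqxx mulg1 arrowK.
Qed.

Lemma lambda_gen1_neq0 : lambda_gen 1%g != 0.
Proof.
have [A A1 vE] := verticesP D.
have vA : vertices D A.
  by rewrite vE; exists 1%g; [split; rewrite ?invg1|exact: translate1].
have [|e _] := @insub_arrow _ D A 1%g vA; first by split; rewrite ?invg1.
apply/eqP => E0; have := groupoid_mul1 << e >>; rewrite E0 pmul0l.
by move=> /esym/eqP; rewrite monalgU_eq0 oner_eq0.
Qed.

Definition groupoid_algebra of finite_set (vertices D) : Type := M.
Local Notation KD := (groupoid_algebra fin).

HB.instance Definition _ := GRing.Lmodule.on KD.
HB.instance Definition _ := GRing.Zmodule_isNzRing.Build KD groupoid_mulA
  groupoid_mul1 groupoid_mulr1 (@pmulDl _ _ _) (@pmulDr _ _ _) lambda_gen1_neq0.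
HB.instance Definition _ := GRing.Lmodule_isLalgebra.Build K KD (@pmulZl _ _ _).
HB.instance Definition _ := GRing.Lalgebra_isAlgebra.Build K KD (@pmulZr _ _ _).

Lemma lambda_gen_relations : @par_relations G KD lambda_gen.
Proof.
have ext (a b : M) : (forall f : arrow, mul a << f >> = mul b << f >>) -> a = b.
  move=> ab; suff E c : mul a c = mul b c.
    by have := E (lambda_gen 1%g); rewrite !groupoid_mulr1.
  elim/malg_basis_ind: c => [|c d Hc Hd|k c Hc|f]; last exact: ab.
  - by rewrite !pmul0r.
  - by rewrite !pmulDr Hc Hd.
  - by rewrite -!pmulZr Hc.
pose l := lambda_gen; split=> [g h|g h|//]; apply: ext => f.
- change (mul (mul (mul (l g) (l h)) (l h^-1%g)) << f >> =
          mul (mul (l (g * h)%g) (l h^-1%g)) << f >>).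
  rewrite -3!groupoid_mulA lambda_genU 3!lambda_gen_basis.
  by rewrite translate_arrow_rel1.
- change (mul (mul (mul (l g^-1%g) (l g)) (l h)) << f >> =
          mul (mul (l g^-1%g) (l (g * h)%g)) << f >>).
  rewrite -3!groupoid_mulA 2!lambda_genU 3!lambda_gen_basis.
  by rewrite translate_arrow_rel2.
Qed.

Definition lambda : par_algebra K G -> KD := par_lift lambda_gen_relations.
HB.instance Definition _ := GRing.LRMorphism.on lambda.

Lemma lambda_par_gen g :
  lambda (par_gen K g) = \sum_(f \in labelled g) (<< f >> : M).
Proof. by rewrite -lambda_genE; exact: par_lift_gen. Qed.

Definition groupoid_module of finite_set (vertices D) : Type := M.
Local Notation KDmod := (groupoid_module fin).
HB.instance Definition _ := GRing.Zmodule.on KDmod.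

Definition groupoid_module_scale (x : par_algebra K G) (a : KDmod) : KDmod :=
  lambda x * (a : KD).

Lemma groupoid_module_scaleA x y a :
  groupoid_module_scale x (groupoid_module_scale y a) =
  groupoid_module_scale (x * y) a.
Proof. by rewrite /groupoid_module_scale rmorphM mulrA. Qed.
Lemma groupoid_module_scale1 : left_id 1 groupoid_module_scale.
Proof. by move=> a; rewrite /groupoid_module_scale rmorph1 mul1r. Qed.
Lemma groupoid_module_scaleDr : right_distributive groupoid_module_scale +%R.
Proof. by move=> x a b; exact: (@mulrDr KD). Qed.
Lemma groupoid_module_scaleDl a :
  {morph groupoid_module_scale^~ a : x y / x + y}.
Proof. by move=> x y; rewrite /groupoid_module_scale rmorphD; exact: (@mulrDl KD). Qed.
HB.instance Definition _ := GRing.Zmodule_isLmodule.Build (par_algebra K G) KDmod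
  groupoid_module_scaleA groupoid_module_scale1 groupoid_module_scaleDr
  groupoid_module_scaleDl.

Lemma groupoid_module_scaleE (g : G) (a : KDmod) :
  par_gen K g *: a = lambda (par_gen K g) * (a : KD).
Proof. by []. Qed.

End GroupoidAlgebra.

(* Main.v *)
Require Import Defs.
From HB Require Import structures.
From mathcomp Require Import all_boot all_algebra finmap.
From mathcomp Require Import boolp classical_sets functions cardinality fsbigop.
From mathcomp Require Import monalg.

Set Implicit Arguments.
Unset Strict Implicit.
Unset Printing Implicit Defensive.

Import GRing.Theory.
Local Open Scope classical_set_scope.
Local Open Scope ring_scope.

(** Write [id_C] for the identity arrow of a vertex [C]. The module [KD] is the
finite sum of its cyclic submodules [R id_C], where [R] is the partial group
algebra, because the arrow [(C, g)] is [[g] id_C]. If [KD] is projective, the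
resulting surjection onto [KD] from a product of copies of [R] ([combine]) has a
section; let [u] be the coordinate at [A] of the image of [id_A]. The coefficient
of [id_A] in [u id_A] is [1], since the other coordinates contribute only arrows
with other sources. For every [h] outside [A] we have [[h][h^-1] u = 0], since
[[h][h^-1] id_A = 0] and the section is linear.

Now [u] is a combination of finitely many words, and whether a word acts on
[id_C] as zero, or takes it to the arrow labelled by the product of its letters,
depends only on whether [C] contains finitely many given elements (the inverses
of the products of the suffixes of the word). Choose [h] outside [A] and outside
the finite set of all elements tested by the words of [u]; this is possible
because the complement of [A] is infinite. On [C = A + {h}] the element [u] acts
as it does on [A], so the coefficient of [id_C] in [u id_C] is again [1]
([run_sum_local]). But [[h][h^-1]] preserves that coefficient because [h] lies
in [C], while it kills [u], so the coefficient is [0] ([run_sum_annihilated]).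

The set [C] need not lie in a component with finitely many vertices, so the
action on [id_C] cannot be read off from a groupoid algebra with unit. It is
obtained from the free algebra: words act on the pointed set [option G] by
partial left translations ([run]), [Some k] standing for the arrow [(C, k)] and
[None] for zero, and the functionals [run_sum] vanish on the ideal of relations
([run_sum_par_ideal]). *)

(** * Partial translations restricted to a subset *)

Section PartialTranslations.
Context (G : groupType).
Implicit Types (C : set G) (g h k : G) (w : free_monoid G) (o : option G).

(** [Some k] is admissible exactly when [(C, k)] can be an arrow with source [C].
The relations of the partial group algebra hold on these states; on the others
[[1]] would act as zero. *)
Definition admissible C o : Prop := if o is Some k then C k^-1%g else True.

Definition step C g o : option G :=
  obind (fun k => if `[< C (g * k)^-1%g >] then Some (g * k)%g else None) o.

Definition run C w o : option G := foldr (step C) o w.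

Lemma step_admissible C g o : admissible C (step C g o).
Proof. by case: o => [k|] //=; case: asboolP. Qed.

Lemma run_admissible C w o : admissible C o -> admissible C (run C w o).
Proof. by case: w => [//|g w _]; exact: step_admissible. Qed.

Lemma step1 C o : admissible C o -> step C 1%g o = o.
Proof. by case: o => [k|] //= Ck; rewrite mul1g asboolT. Qed.

Lemma step_rel1 C g h o : admissible C o ->
  step C g (step C h (step C h^-1%g o)) = step C (g * h)%g (step C h^-1%g o).
Proof.
case: o => [k|] //= Ck; case: asboolP => //= _.
by rewrite mulVKg asboolT //= -mulgA mulVKg.
Qed.

Lemma step_rel2 C g h o : admissible C o ->
  step C g^-1%g (step C g (step C h o)) = step C g^-1%g (step C (g * h)%g o).
Proof.
case: o => [k|] //= Ck; case: (asboolP (C (h * k)^-1%g)) => /= nC.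
  by rewrite mulgA.
case: asboolP => //= _.
by rewrite -mulgA mulKg asboolF.
Qed.

(** For [g] in [C] the operator [[g][g^-1]] fixes [id_C]; elsewhere it fixes a
state or sends it to [None], so [id_C] has no other preimage. *)
Lemma step_stepV C g o : admissible C o -> C g ->
  (step C g (step C g^-1%g o) == Some 1%g) = (o == Some 1%g).
Proof.
case: o => [k|] //= Ck Cg; case: asboolP => [_|nC] /=.
  by rewrite mulVKg asboolT.
apply/esym/eqP => -[k1]; apply: nC.
by rewrite k1 mulg1 invgK.
Qed.

(** The elements whose membership in [C] decides whether the word survives on
[id_C]. *)
Fixpoint word_trail w : seq G :=
  if w is g :: w' then (\prod_(x <- w) x)^-1%g :: word_trail w' else [::].

Lemma run1E C w : run C w (Some 1%g) =
  if all (fun x => `[< C x >]) (word_trail w) then Some (\prod_(x <- w) x)%g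
  else None.
Proof.
elim: w => [|g w IH] /=; first by rewrite big_nil.
rewrite IH andbC; case: all => //=.
by rewrite big_cons.
Qed.

End PartialTranslations.

(** * Functionals on the partial group algebra *)

Section RunCoefficient.
Context (K : fieldType) (G : groupType).
Local Notation F := {malg K[free_monoid G]}.
Implicit Types (C : set G) (a b x : F) (o : option G) (f : option G -> K).

(** The value of the functional [f] on the action of [a] on the state [o]. With a
functional as parameter, left multiplication by a word becomes precomposition
of [f] and right multiplication a change of the state. *)
Definition run_sum C a o f : K := mmap idfun (fun w => f (run C w o)) a.

Lemma run_sumE C a o f :
  run_sum C a o f = \sum_(w <- msupp a) a@_w * f (run C w o).
Proof. exact: mmapE. Qed.

Lemma run_sumD C o f : {morph (fun a => run_sum C a o f) : a b / a + b}.
Proof. exact: mmapD. Qed.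

Lemma run_sumB C o f : {morph (fun a => run_sum C a o f) : a b / a - b}.
Proof. exact: mmapB. Qed.

Lemma run_sum0 C o f : run_sum C 0 o f = 0.
Proof. exact: mmap0. Qed.

Lemma run_sumZ C c a o f : run_sum C (c *: a) o f = c * run_sum C a o f.
Proof.
rewrite /run_sum (mmapEw (msuppZ_le _ _)) mmapE mulr_sumr.
by apply: eq_bigr => w _; rewrite mcoeffZ /= mulrA.
Qed.

Lemma run_sumU C (w : free_monoid G) o f :
  run_sum C << w >> o f = f (run C w o).
Proof. by rewrite /run_sum mmapU /= mul1r. Qed.

Lemma mul_word (u v : free_monoid G) :
  (<< u >> : F) * << v >> = << (u ++ v : free_monoid G) >>.
Proof. by rewrite malgM_def fgmulUU mulr1. Qed.

Lemma run_sum_word_mul C (u : free_monoid G) x (v : free_monoid G) o f :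
  run_sum C (<< u >> * x * << v >>) o f = run_sum C x (run C v o) (f \o run C u).
Proof.
elim/malg_basis_ind: x => [|x y Hx Hy|c x Hx|w].
- by rewrite mulr0 mul0r !run_sum0.
- rewrite (mulrDr _ x y) (mulrDl (<< u >> * x)) [RHS]run_sumD.
  exact: etrans (run_sumD _ _ _ _ _) (congr2 +%R Hx Hy).
- by rewrite -free_algebra_scalerAr -scalerAl !run_sumZ Hx.
by rewrite !mul_word !run_sumU /= /run !foldr_cat.
Qed.

(** The elements that act as zero on all admissible states form a two-sided
ideal: words preserve admissibility, and the functional is arbitrary. *)
Lemma run_sum_mul_eq0 C x :
  (forall o f, admissible C o -> run_sum C x o f = 0) ->
  forall a b o f, admissible C o -> run_sum C (a * x * b) o f = 0.
Proof.
move=> x0 a b o f Co; elim/malg_basis_ind: a => [|a a' Ha Ha'|c a Ha|u].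
- by rewrite !mul0r run_sum0.
- rewrite (mulrDl a a' x) (mulrDl (a * x)).
  exact: etrans (run_sumD _ _ _ _ _) (etrans (congr2 +%R Ha Ha') (addr0 0)).
- by rewrite -!scalerAl run_sumZ Ha mulr0.
elim/malg_basis_ind: b => [|b b' Hb Hb'|c b Hb|v].
- by rewrite !mulr0 run_sum0.
- rewrite (mulrDr _ b b').
  exact: etrans (run_sumD _ _ _ _ _) (etrans (congr2 +%R Hb Hb') (addr0 0)).
- by rewrite -free_algebra_scalerAr run_sumZ Hb mulr0.
by rewrite run_sum_word_mul x0 //; exact: run_admissible.
Qed.

(** The action of the free algebra on admissible states factors through the
partial group algebra, because each relator is a difference of two words that
act in the same way. *)
Lemma run_sum_par_ideal C a o f :
  par_ideal a -> admissible C o -> run_sum C a o f = 0.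
Proof.
pose I : set F := [set a | forall o f, admissible C o -> run_sum C a o f = 0].
suff sub : @par_ideal K G `<=` I by move=> /sub; apply.
have word2 (u v : free_monoid G) :
    (forall o, admissible C o -> run C u o = run C v o) -> I (<< u >> - << v >>).
  by move=> uv o' f' Co; rewrite run_sumB !run_sumU uv ?subrr.
apply: smallest_sub.
  split=> [o' f' _|x y Ix Iy o' f' Co|a' x b Ix]; first exact: run_sum0.
    by rewrite run_sumB Ix // Iy // subrr.
  exact: run_sum_mul_eq0.
move=> r [[|]|].
- move=> [g [h ->]]; rewrite /letter !mul_word; apply: word2 => o' Co /=.
  exact: step_rel1.
- move=> [g [h ->]]; rewrite /letter !mul_word; apply: word2 => o' Co /=.
  exact: step_rel2.
move=> ->; apply: (word2 [:: 1%g] [::]) => o' Co /=.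
exact: step1.
Qed.

Definition delta1 o : K := (o == Some 1%g)%:R.

(** The coefficient of [id_C] in [a id_C] depends only on finitely many membership
questions about [C]. *)
Lemma run_sum_local C C' a :
  (forall w (y : G), w \in msupp a -> y \in word_trail w -> C y <-> C' y) ->
  run_sum C a (Some 1%g) delta1 = run_sum C' a (Some 1%g) delta1.
Proof.
move=> CC'; rewrite !run_sumE [LHS]big_seq [RHS]big_seq; apply: eq_bigr => w wa.
rewrite !run1E; congr (_ * delta1 (if _ then _ else _)).
by apply: eq_in_all => y yw; apply/asboolP/asboolP => /(CC' _ _ wa yw).
Qed.

(** If [h] is in [C], then [[h][h^-1]] does not change coefficients at [id_C], so
an element that it annihilates has coefficient zero there. *)
Lemma run_sum_annihilated C h a : C 1%g -> C h ->
  par_gen K h * par_gen K h^-1%g * par_pi a = 0 ->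
  run_sum C a (Some 1%g) delta1 = 0.
Proof.
move=> C1 Ch.
have <- : @par_pi K G 0 = 0 by rewrite /par_pi raddf0.
rewrite -!par_pi_mulr => /par_piP.
(* The factor [1] is the empty word on the right of [a]. *)
rewrite subr0 /letter mul_word -[a in _ * a]mulr1 mulrA => Ia.
have adm : admissible C (Some 1%g) by rewrite /= invg1.
have := run_sum_par_ideal delta1 Ia adm.
rewrite (run_sum_word_mul _ _ _ [::]) => <-.
rewrite !run_sumE; apply: eq_bigr => w _; rewrite /= /delta1 step_stepV //.
exact: run_admissible.
Qed.

End RunCoefficient.

(** * The action on the groupoid algebra *)

Section GroupoidModule.
Context (K : fieldType) (G : groupType) (D : component G).
Hypothesis fin : finite_set (vertices D).
Local Notation KD := (groupoid_module K fin).
Local Notation R := (par_algebra K G).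
Implicit Types (A C : set G) (g h k : G) (o : option G).

Definition state_arrow C o : KD :=
  basis_or0 K (obind (fun k => insub (C, k)) o : option (arrow D)).

Lemma par_genZ g (m : KD) :
  par_gen K g *: m = pmul (@arrow_comp G D) (lambda_gen K D g) m.
Proof.
by rewrite groupoid_module_scaleE lambda_par_gen lambda_genE.
Qed.

Lemma par_genZ_state g C o : vertices D C -> admissible C o ->
  par_gen K g *: state_arrow C o = state_arrow C (step C g o).
Proof.
move=> vC; have C1 := vertices_vertex vC.
rewrite par_genZ /state_arrow (lambda_gen_basis _ fin) => Co; congr basis_or0.
case: o Co => [k|] //= Ck.
have [|e [-> se le]] := @insub_arrow _ D C k vC; first by split.
rewrite /= (translate_arrow_eq se (erefl _)) le.
by case: asboolP => // nC; rewrite insubF //; apply/asboolP => -[_ []].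
Qed.

(** For a vertex [C] of the component, the partial translations of [option G]
describe the module structure on the arrows with source [C]. *)
Lemma wordZ_state (w : free_monoid G) C o : vertices D C -> admissible C o ->
  par_pi << w >> *: state_arrow C o = state_arrow C (run C w o).
Proof.
move=> vC Co; elim: w => [|g w IH]; first exact: scale1r.
rewrite -[in LHS](cat1s g w) -mul_word par_pi_mulr -scalerA IH.
by apply: par_genZ_state => //; exact: run_admissible.
Qed.

Lemma par_piZ_state_coef (a : {malg K[free_monoid G]}) C o (e : arrow D) :
  vertices D C -> admissible C o ->
  (par_pi a *: state_arrow C o : {malg K[arrow D]})@_e =
  run_sum C a o (fun o' => (state_arrow C o' : {malg K[arrow D]})@_e).
Proof.
move=> vC Co; elim/malg_basis_ind: a => [|a b Ha Hb|c a Ha|w].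
- by rewrite /par_pi raddf0 scale0r run_sum0 mcoeff0.
- by rewrite par_piD scalerDl run_sumD -Ha -Hb mcoeffD.
- rewrite run_sumZ -Ha par_pi_scaler -mcoeffZ; congr mcoeff.
  rewrite /GRing.scale /= /groupoid_module_scale linearZ.
  by rewrite -[LHS](@scalerAl _ (groupoid_algebra K fin)).
by rewrite run_sumU wordZ_state.
Qed.

Definition unit_arrow C : KD := state_arrow C (Some 1%g).

(** Arrows remember their source, so [id_A] occurs only among the
states of [A]. *)
Lemma unit_coef_state A C o (e : arrow D) : insub (A, 1%g) = Some e ->
  (state_arrow C o : {malg K[arrow D]})@_e = (C == A)%:R * delta1 K o.
Proof.
case: insubP => // e1 _ ev [e1e]; rewrite {e1}e1e in ev.
rewrite /state_arrow /delta1 -natrM mulnb.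
case: o => [k|] /=; last by rewrite mcoeff0 andbF.
case: insubP => [e' _ e'v|] /=.
  rewrite mcoeffU.
  by rewrite -(inj_eq val_inj) /= e'v ev.
case: andP => [[/eqP -> /eqP [->]] /negP []|]; last by rewrite mcoeff0.
by have := valP e; rewrite ev.
Qed.

Lemma unit_coef_par_pi (a : {malg K[free_monoid G]}) A C (e : arrow D) :
  vertices D C -> insub (A, 1%g) = Some e ->
  (par_pi a *: unit_arrow C : {malg K[arrow D]})@_e =
  (C == A)%:R * run_sum C a (Some 1%g) (@delta1 K G).
Proof.
move=> vC eA; rewrite par_piZ_state_coef //; last first.
  by rewrite /= invg1; exact: vertices_vertex vC.
rewrite !run_sumE mulr_sumr; apply: eq_bigr => w _.
by rewrite (unit_coef_state _ _ eA) mulrCA.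
Qed.

(** The surjection that is split when [KD] is projective. Its domain is a product of
copies of the regular module indexed by all subsets of [G], so that a subset can
be used as a coordinate without a proof that it is a vertex; the finite sum
reads only the coordinates at vertices. *)
Definition combine (x : set G -> R^o) : KD :=
  \sum_(C <- fset_set (vertices D)) (x C : R) *: unit_arrow C.

Lemma combine_is_linear : linear combine.
Proof.
move=> c x y; rewrite /combine scaler_sumr -big_split; apply: eq_bigr => C _.
rewrite scalerA; exact: scalerDl.
Qed.
HB.instance Definition _ :=
  GRing.isLinear.Build R (set G -> R^o) KD _ combine combine_is_linear.

Lemma combine_surj (y : KD) : exists x, combine x = y.
Proof.
elim/malg_basis_ind: y => [|y z [x <-] [x' <-]|c y [x <-]|f].
- by exists 0; rewrite linear0.
- by exists (x + x'); rewrite linearD.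
(* A scalar of the field acts on the module as its image in [R]. *)
- exists ((c *: 1 : R) *: x); rewrite linearZ /=.
  rewrite /GRing.scale /= /groupoid_module_scale linearZ rmorph1.
  rewrite -[LHS](@scalerAl _ (groupoid_algebra K fin)).
  by rewrite (@mul1r (groupoid_algebra K fin)).
have [vf [f1 fl]] := arrowP f.
exists (fun C => if C == source f then par_gen K (label f) else 0).
rewrite /combine (bigD1_seq (source f)) ?fset_uniq //=; last first.
  by rewrite in_fset_set // mem_set.
rewrite eqxx big1 ?addr0 => [|C /negPf ->]; last by rewrite scale0r.
rewrite /unit_arrow par_genZ_state //; last by rewrite /= invg1.
by rewrite /= mulg1 asboolT //= /state_arrow /= arrowK.
Qed.

End GroupoidModule.

Theorem proposition6p1 (K : fieldType) (G : groupType) (Delta : component G)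
    (fin : finite_set (vertices Delta)) (A : set G) :
  vertices Delta A -> infinite_set (~` A) ->
  ~ projective (groupoid_module K fin : lmodType (par_algebra K G)).
Proof.
move=> vA infA proj; have A1 := vertices_vertex vA.
have [s sE] := proj _ _ (@combine K G Delta fin) idfun (@combine_surj K G Delta fin).
have [|e [eA _ _]] := @insub_arrow _ Delta A 1%g vA; first by rewrite /is_arrow invg1.
(* Only the coordinate at [A] can contribute to the coefficient of [e]. *)
pose u := s (unit_arrow K fin A) A; pose a := par_repr u.
have coefA : run_sum A a (Some 1%g) (@delta1 K G) = 1.
  have := congr1 (mcoeff e) (sE (unit_arrow K fin A)).
  rewrite /= (unit_coef_state _ _ _ _ eA) eqxx /delta1 eqxx mulr1 => coef1.
  rewrite -[RHS]coef1.
  rewrite /combine raddf_sum (bigD1_seq A) ?fset_uniq //=; last first.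
    by rewrite in_fset_set // mem_set.
  rewrite -[s _ A]par_reprK (unit_coef_par_pi fin _ vA eA) eqxx mul1r.
  rewrite big_seq_cond big1 ?addr0 // => C /andP[].
  rewrite in_fset_set // => /set_mem vC /negPf CA.
  by rewrite -[s _ C]par_reprK (unit_coef_par_pi fin _ vC eA) CA mul0r.
pose T := flatten [seq word_trail w | w <- msupp a].
have [h [nAh nTh]] := infinite_setN0 (infinite_setD infA (finite_seq T)).
have hu : par_gen K h * par_gen K h^-1%g * par_pi a = 0.
  have admA : admissible A (Some 1%g) by rewrite /= invg1.
  rewrite par_reprK.
  transitivity ((par_gen K h *: (par_gen K h^-1%g *: s (unit_arrow K fin A))) A).
    by rewrite -mulrA.
  rewrite -!linearZ par_genZ_state //= mulg1 invgK asboolF //.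
  by rewrite /state_arrow /= scaler0 linear0.
(* The enlarged set [A `|` [set h]] gives the coefficient both values 0 and 1. *)
have := @run_sum_annihilated K G (A `|` [set h]) h a (or_introl A1) (or_intror erefl) hu.
rewrite -(@run_sum_local K G A) ?coefA; first by move/eqP; rewrite oner_eq0.
move=> w x wa xw; split=> [|[//|xh]]; first by left.
case: nTh; rewrite -xh; apply/flatten_mapP; by exists w.
Qed.
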